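(* Let $K$ be a field with $\operatorname{char}K=0$ and let $F=x+H:K^n\to K^n$ be an invertible polynomial map of degree $d$. If $\ker JH\cap K^n$ has dimension $n-r$ as a $K$-vector space, then the inverse polynomial map of $F$ has degree at most $d^r$.
   Context: Here $n\ge 1$, $x=(x_1,\dots,x_n)^t$ is the identity map, and $H=F-x\in K[x_1,\dots,x_n]^n$. A polynomial map $F=(F_1,\dots,F_n)^t$ with $F_i\in K[x_1,\dots,x_n]$ is invertible if there is a polynomial map $\tilde F$ over $K$ with $F\circ\tilde F=\tilde F\circ F=x$ (as tuples of polynomials). The degree of a polynomial map is the maximum of the degrees of its components. $JH=(\partial H_i/\partial x_j)_{1\le i,j\le n}$ is the Jacobian matrix of $H$, and $\ker JH\cap K^n$ is the $K$-vector space of constant vectors $v\in K^n$ such that $JH\cdot v=0$ in $K[x_1,\dots,x_n]^n$. *)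

(* Defs.v *)
From HB Require Import structures.
From mathcomp Require Import all_boot all_order all_algebra.
From mathcomp Require Import mpoly.

Set Implicit Arguments.
Unset Strict Implicit.
Unset Printing Implicit Defensive.

Import GRing.Theory.
Local Open Scope ring_scope.

(* A polynomial map K^n -> K^n is a column of n polynomials in n variables. *)
Notation polymap K n := 'cV[{mpoly K[n]}]_n.

Definition polymap_id (K : fieldType) (n : nat) : polymap K n :=
  \col_(i < n) 'X_i.

(* F o G, obtained by substituting G_j for the j-th variable in each F_i. *)
Definition polymap_comp (K : fieldType) (n : nat) (F G : polymap K n) :
    polymap K n :=
  \col_(i < n) (F i ord0 \mPo [tuple G j ord0 | j < n]).

Definition polymap_inverse (K : fieldType) (n : nat) (F G : polymap K n) :
    Prop :=
  polymap_comp F G = polymap_id K n /\ polymap_comp G F = polymap_id K n.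

(* [msize p] is 1 + deg p, and 0 when p = 0; a zero component thus counts as
   having degree 0, so it never affects the maximum. *)
Definition polymap_degree (K : fieldType) (n : nat) (F : polymap K n) : nat :=
  \max_(i < n) (msize (F i ord0)).-1.

Definition jacobian (K : fieldType) (n : nat) (H : polymap K n) :
    'M[{mpoly K[n]}]_n :=
  \matrix_(i < n, j < n) mderiv j (H i ord0).

(* ker A \cap K^n, where K^n is embedded in K[x_1, ..., x_n]^n as the constant
   vectors. *)
Definition const_ker (K : fieldType) (n : nat) (A : 'M[{mpoly K[n]}]_n) :
    {pred 'cV[K]_n} :=
  [pred v | A *m map_mx (@mpolyC n K) v == 0].

(* Main.v *)
Require Import Defs.
From HB Require Import structures.
From mathcomp Require Import all_boot all_order all_algebra.
From mathcomp Require Import mpoly.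
From mathcomp Require Import zify.

(* Since char K = 0, H is invariant under translation by V = ker JH, so modulo V
   the map F = x + H induces an automorphism f of K^r, of degree at most d.  The
   component H_i(G) of x - G is, up to a linear projection onto K^r, a polynomial
   P in r variables such that P(f) is the restriction of H_i, hence deg P(f) <= d.
   It remains to see that D := deg P <= d^r.  Write c(b) for the number of monomials
   of degree at most b in r variables.  There are D c(b) products of a monomial
   and a power of P which have distinct leading monomials and whose images under
   the injective substitution of f have degree at most d (b + D).  Hence
   D c(b) <= c(d (b + D)) <= d^r c(b + D) for all b, and D > d^r would force c to
   grow exponentially. *)

Set Implicit Arguments.
Unset Strict Implicit.
Unset Printing Implicit Defensive.

Import Order.TTheory GRing.Theory.
Local Open Scope ring_scope.

(** * Exponential versus polynomial growth of natural numbers *)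

(** Bernoulli's inequality (1 + 1/q)^j >= 1 + j/q with denominators cleared. *)
Lemma leq_expn_bernoulli (q j : nat) : (q ^ j * (q + j) <= q.+1 ^ j * q)%N.
Proof.
elim: j => [|j IHj]; first by rewrite !expn0 addn0.
rewrite !expnS -mulnA; move: (q ^ j)%N (q.+1 ^ j)%N IHj => x y; nia.
Qed.

Lemma expn_outgrows_linear (c : nat) : exists w, (1 + c * w < 2 ^ w)%N.
Proof.
(* With this exponent, 2 ^ w is the square of 2 ^ (2c + 1) > 2c + 1, and (2c + 2)^2 exceeds 1 + c(4c
   + 2). *)
exists (c.*2.+1 * 2)%N; rewrite expnM.
have := ltn_expl c.*2.+1 (ltnSn 1); move: (2 ^ _)%N => x; nia.
Qed.

(** If q < a, Bernoulli gives (a/q)^q >= 2, so the hypothesis at j = q s bounds 2 ^ s by a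
    polynomial in s. *)
Lemma leq_of_expn_leq_poly (a q c k : nat) :
  (forall j, a ^ j <= q ^ j * (1 + j * c) ^ k)%N -> (a <= q)%N.
Proof.
move=> le_aq; rewrite leqNgt; apply/negP => lt_qa.
have q_gt0 : (0 < q)%N.
  by case: q lt_qa le_aq => // lt0a /(_ 1%N); rewrite expn1 mul0n leqNgt lt0a.
have two_q : (2 * q ^ q <= a ^ q)%N.
  have := leq_expn_bernoulli q q; have : (q.+1 ^ q <= a ^ q)%N by rewrite leq_exp2r.
  move: (q ^ q)%N (q.+1 ^ q)%N (a ^ q)%N => x y z; nia.
have two_s s : (2 ^ s <= (1 + q * s * c) ^ k)%N.
  have qs_gt0 : (0 < q ^ (q * s))%N by rewrite expn_gt0 q_gt0.
  rewrite -(leq_pmul2l qs_gt0); apply: leq_trans (le_aq _).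
  by rewrite mulnC expnM -expnMn (expnM a); case: s {qs_gt0} => // s; rewrite leq_exp2r.
case: (posnP k) => [k0|k_gt0]; first by have := two_s 1%N; rewrite k0.
(* Taking s = w k and extracting k-th roots reduces the polynomial bound to a linear one. *)
have [w] := expn_outgrows_linear (q * k * c); apply/negP; rewrite -leqNgt.
rewrite -(leq_exp2r _ _ k_gt0) -expnM.
apply: leq_trans (two_s _) _; rewrite leq_exp2r //; nia.
Qed.

(** * Counting monomials of bounded degree *)

Section BoundedMonomials.

Variable k : nat.

Lemma card_bmnm_leq_expn (b : nat) : (#|{: 'X_{1..k < b}}| <= b ^ k)%N.
Proof.
have lt_b (u : 'X_{1..k < b}) i : (bmnm u i < b)%N.
  apply: leq_ltn_trans (bmdeg u); rewrite mdegE (bigD1 i) //=; exact: leq_addr.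
pose h (u : 'X_{1..k < b}) := [ffun i : 'I_k => Ordinal (lt_b u i)].
have h_inj : injective h.
  move=> u v /ffunP huv; apply/val_inj/mnmP => i.
  by have := huv i; rewrite !ffunE => /(congr1 val).
by apply: leq_trans (leq_card h h_inj) _; rewrite card_ffun !card_ord.
Qed.

Lemma card_bmnm_gt0 (b : nat) : (0 < #|{: 'X_{1..k < b.+1}}|)%N.
Proof. by apply/card_gt0P; exists (BMultinom (bm0_proof k b)). Qed.

(** Divide every exponent by d: the remainders take d ^ k values, and the quotients form a monomial
    of degree at most a. *)
Lemma card_bmnm_scale (d a : nat) : (0 < d)%N ->
  (#|{: 'X_{1..k < (d * a).+1}}| <= d ^ k * #|{: 'X_{1..k < a.+1}}|)%N.
Proof.
move=> d_gt0.
have lt_q (u : 'X_{1..k < (d * a).+1}) :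
    (mdeg [multinom (bmnm u i %/ d)%N | i < k] < a.+1)%N.
  rewrite ltnS -(leq_pmul2l d_gt0).
  have := bmdeg u; rewrite ltnS; apply: leq_trans.
  rewrite !mdegE big_distrr leq_sum // => i _.
  by rewrite mnmE /= [leqLHS]mulnC leq_trunc_div.
have lt_r (u : 'X_{1..k < (d * a).+1}) i : (bmnm u i %% d < d)%N.
  by rewrite ltn_mod.
pose h (u : 'X_{1..k < (d * a).+1}) :=
  ([ffun i : 'I_k => Ordinal (lt_r u i)], BMultinom (lt_q u)).
have h_inj : injective h.
  move=> u v huv; have /ffunP hr := congr1 fst huv.
  have /mnmP hq := congr1 (fun x => val x.2) huv.
  apply/val_inj/mnmP => i.
  have := hr i; rewrite !ffunE => /(congr1 val) /= er.
  have := hq i; rewrite !mnmE => eq_q.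
  by rewrite (divn_eq (val u i) d) eq_q er -divn_eq.
by apply: leq_trans (leq_card h h_inj) _; rewrite card_prod card_ffun !card_ord.
Qed.

(** Iterating along b = 0, D, 2D, ... yields D ^ j <= (d ^ k) ^ j * c(j D), where the number c(j D)
    of monomials of degree at most j D is polynomial in j. *)
Lemma leq_of_card_bmnm (d D : nat) : (0 < d)%N ->
  (forall b, D * #|{: 'X_{1..k < b.+1}}| <= #|{: 'X_{1..k < (d * (b + D)).+1}}|)%N ->
  (D <= d ^ k)%N.
Proof.
move=> d_gt0 le_card.
have step b : (D * #|{: 'X_{1..k < b.+1}}| <= d ^ k * #|{: 'X_{1..k < (b + D).+1}}|)%N.
  exact: leq_trans (le_card b) (card_bmnm_scale _ d_gt0).
apply: (@leq_of_expn_leq_poly _ _ D k) => j.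
apply: leq_trans (_ : _ <= (d ^ k) ^ j * #|{: 'X_{1..k < (j * D).+1}}|)%N _; last first.
  by rewrite leq_mul2l card_bmnm_leq_expn orbT.
elim: j => [|j IHj]; first by rewrite !expn0 mul1n card_bmnm_gt0.
rewrite !expnS mulSn addnC -mulnA.
apply: leq_trans (leq_mul (leqnn D) IHj) _.
have := step (j * D)%N; move: (d ^ k)%N => x.
move=> /(leq_mul (leqnn (x ^ j)%N)); nia.
Qed.

(** Listing the variables of m with multiplicity, in some order, fixes a chain of divisors from 1 up
    to m. *)
Lemma mnm_sum_units (m : 'X_{1..k}) :
  exists2 s : seq 'I_k, size s = mdeg m & m = (\sum_(i <- s) U_(i))%MM.
Proof.
have [D] := ubnP (mdeg m); elim: D m => // D IHD m; rewrite ltnS => leD.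
have [->|] := eqVneq m 0%MM; first by exists [::]; rewrite ?big_nil ?mdeg0.
rewrite -mdeg_eq0 => m_neq0.
have /existsP[i i_gt0] : [exists i, 0 < m i]%N.
  apply: contraNT m_neq0; rewrite negb_exists => /forallP m0.
  by rewrite mdegE big1 // => i _; have := m0 i; rewrite lt0n negbK => /eqP.
have Em : m = (U_(i) + (m - U_(i)))%MM.
  by rewrite addmC submK //; apply/mnm_lepP => j; rewrite mnm1E; case: eqP => // <-.
have degE : mdeg m = (mdeg (m - U_(i))%MM).+1 by rewrite {1}Em mdegD mdeg1.
have [|s size_s Es] := IHD (m - U_(i))%MM; first by rewrite -ltnS -degE.
by exists (i :: s); rewrite /= ?size_s ?degE // big_cons -Es.
Qed.

End BoundedMonomials.

(** * Unique division by powers of a monomial, written additively *)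

Section MonomialDivision.

Variable k : nat.
Implicit Types (m a u : 'X_{1..k}) (s : seq 'I_k).

(** If j < j', cancelling [m *+ j] would make m divide a. *)
Lemma mnm_euclid_inj m a a' (j j' : nat) :
  ~~ (m <= a)%MM -> ~~ (m <= a')%MM ->
  (a + m *+ j = a' + m *+ j')%MM -> a = a' /\ j = j'.
Proof.
wlog le_jj' : a a' j j' / (j <= j')%N => [hw ma ma' E|ma ma' /mnmP E].
  case: (leqP j j') => [/hw|/ltnW/hw]; first exact.
  by move=> /(_ a' a ma' ma (esym E)) [-> ->].
case: (ltngtP j j') le_jj' => // [lt_jj'|eq_jj'] _.
  case/negP: ma; apply/mnm_lepP => i; move: (E i).
  rewrite !mnmDE !mulmnE; nia.
split=> //; apply/mnmP => i; move: (E i).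
by rewrite !mnmDE !mulmnE eq_jj' => /addIn.
Qed.

Definition mnm_chain s (t : nat) : 'X_{1..k} := (\sum_(i <- take t s) U_(i))%MM.

Definition mnm_drop (i : 'I_k) u : 'X_{1..k} :=
  [multinom if j == i then 0%N else u j | j < k].

(** The second factor is free of the t-th variable of s, so the residue is divisible by
    [mnm_chain s t] but not by [mnm_chain s t.+1]. *)
Definition mnm_residue s (t : 'I_(size s)) u : 'X_{1..k} :=
  (mnm_chain s t + mnm_drop (tnth (in_tuple s) t) u)%MM.

Lemma mnm_chainS s (t : 'I_(size s)) :
  mnm_chain s t.+1 = (mnm_chain s t + U_(tnth (in_tuple s) t))%MM.
Proof.
have x0 : 'I_k by case: s t => [|i s] // [].
rewrite /mnm_chain (tnth_nth x0) /= (take_nth x0) //.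
by rewrite -cats1 big_cat big_seq1.
Qed.

Lemma mnm_chain_homo s (t t' : nat) :
  (t <= t')%N -> (mnm_chain s t <= mnm_chain s t')%MM.
Proof.
move=> le_tt'; rewrite /mnm_chain -(cat_take_drop t (take t' s)) big_cat /=.
by rewrite take_takel // lem_addr.
Qed.

Lemma mnm_residue_at s (t : 'I_(size s)) u :
  (mnm_residue t u (tnth (in_tuple s) t) <
   mnm_chain s t.+1 (tnth (in_tuple s) t))%N.
Proof.
rewrite mnm_chainS /mnm_residue !mnmDE mnmE /= eqxx mnm1E eqxx; lia.
Qed.

Lemma mnm_residue_ndvd s m (t : 'I_(size s)) u :
  m = (\sum_(i <- s) U_(i))%MM -> ~~ (m <= mnm_residue t u)%MM.
Proof.
move=> Em; apply/negP => /mnm_lepP /(_ (tnth (in_tuple s) t)).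
apply/negP; rewrite -ltnNge; apply: leq_trans (mnm_residue_at t u) _.
have -> : m = mnm_chain s (size s) by rewrite /mnm_chain take_size.
exact/mnm_lepP/mnm_chain_homo.
Qed.

(** If t < t', then [mnm_chain s t.+1] divides the second residue but not the first. *)
Lemma mnm_residue_time s (t t' : 'I_(size s)) u u' :
  mnm_residue t u = mnm_residue t' u' -> t = t'.
Proof.
wlog le_tt' : t t' u u' / (t <= t')%N => [hw E|E].
  case: (leqP t t') => [/hw|/ltnW/hw]; first by apply; exact: E.
  by move=> /(_ _ _ (esym E)) ->.
apply/val_inj; case: (ltngtP t t') le_tt' => // lt_tt' _.
have := mnm_residue_at t u; rewrite E ltnNge => /negP[].
apply: leq_trans (mnm_lepP (mnm_chain_homo s lt_tt') _) _.
by rewrite mnmDE leq_addr.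
Qed.

(* The monomials not divisible by [m] times powers of [m]: sorting such a
   residue by the last [mnm_chain s t] dividing it leaves one free variable,
   whose exponent in [u] is used to record the power of [m]. *)
Lemma mnm_residue_inj s m (t t' : 'I_(size s)) u u' :
  m = (\sum_(i <- s) U_(i))%MM ->
  (mnm_residue t u + m *+ u (tnth (in_tuple s) t) =
   mnm_residue t' u' + m *+ u' (tnth (in_tuple s) t'))%MM ->
  t = t' /\ u = u'.
Proof.
move=> Em /(mnm_euclid_inj (mnm_residue_ndvd t u Em) (mnm_residue_ndvd t' u' Em)).
case=> E Ej.
have Et := mnm_residue_time E; split=> //; rewrite -{}Et in E Ej.
apply/mnmP => i; have [-> //|ne_i] := eqVneq i (tnth (in_tuple s) t).
have /mnmP/(_ i) := E; rewrite !mnmDE => /addnI.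
by rewrite !mnmE (negPf ne_i).
Qed.

(** The exponent removed from u reappears as the power of m, so counting m as having degree 1 the
    total is still that of u plus t. *)
Lemma mdeg_mnm_residue s (t : 'I_(size s)) u :
  (mdeg (mnm_residue t u) + u (tnth (in_tuple s) t) = t + mdeg u)%N.
Proof.
rewrite mdegD /mnm_chain mdeg_sum (eq_bigr (fun=> 1%N)) => [|i _]; last exact: mdeg1.
rewrite sum1_size size_takel; last exact: ltnW.
rewrite -addnA; congr addn; set i := tnth _ _.
rewrite !mdegE (bigD1 i) //= [in RHS](bigD1 i) //= mnmE eqxx add0n addnC.
by congr addn; apply: eq_bigr => j /negPf ne_j; rewrite mnmE ne_j.
Qed.

End MonomialDivision.

(** * Linear independence by leading monomials, dependence by dimension *)

Section LinearAlgebra.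

Variables (K : fieldType) (k : nat).

(** The largest leading monomial occurring with a nonzero coefficient cannot be cancelled. *)
Lemma mlead_free (I : finType) (q : I -> {mpoly K[k]}) (c : I -> K) :
  (forall i, q i != 0) -> injective (fun i => mlead (q i)) ->
  \sum_i c i *: q i = 0 -> forall i, c i = 0.
Proof.
move=> q_neq0 q_inj sum0 i; apply/eqP; apply: contraT => ci_neq0.
have [i0 ci0 max_i0] := arg_maxP (fun i => mlead (q i)) (ci_neq0 : (fun i => c i != 0) i).
have := congr1 (mcoeff (mlead (q i0))) sum0.
rewrite mcoeff0 raddf_sum /= (bigD1 i0) //= big1 => [|j ne_j].
  rewrite addr0 mcoeffZ => /eqP; rewrite mulf_eq0 (negPf ci0) /=.
  by rewrite mleadc_eq0 (negPf (q_neq0 i0)).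
rewrite mcoeffZ; have [->|cj] := eqVneq (c j) 0; first by rewrite mul0r.
have le_j : (mlead (q j) <= mlead (q i0))%O := max_i0 j cj.
rewrite mcoeff_gt_mlead ?mulr0 // lt_neqAle le_j andbT.
by apply: contra ne_j => /eqP /q_inj ->.
Qed.

(** The matrix of coefficients has more rows than columns, hence a nonzero left kernel. *)
Lemma mpoly_dependent (I : finType) (q : I -> {mpoly K[k]}) (b : nat) :
  (forall i, msize (q i) <= b)%N -> (#|{: 'X_{1..k < b}}| < #|I|)%N ->
  exists2 c : I -> K, (exists i, c i != 0) & \sum_i c i *: q i = 0.
Proof.
move=> q_b lt_card.
pose A := \matrix_(i < #|I|, j < #|{: 'X_{1..k < b}}|)
  (q (enum_val i))@_(bmnm (enum_val j)).
have kerA : kermx A != 0.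
  rewrite kermx_eq0 /row_free; apply: contraTneq (rank_leq_col A) => ->.
  by rewrite -ltnNge.
have [v /sub_kermxP vA v_neq0] := rowV0Pn kerA.
pose c i := v 0 (enum_rank i); exists c.
  have /rV0Pn[j vj] := v_neq0.
  by exists (enum_val j); rewrite /c enum_valK.
apply/mpolyP => m; rewrite mcoeff0 raddf_sum /=.
have [lt_m|ge_m] := ltnP (mdeg m) b; last first.
  rewrite big1 // => i _; rewrite mcoeffZ memN_msupp_eq0 ?mulr0 //.
  by apply: msize_mdeg_ge; apply: leq_trans ge_m.
have := congr1 (fun M : 'rV_ _ => M 0 (enum_rank (BMultinom lt_m))) vA.
rewrite !mxE => S0.
rewrite -[RHS]S0 [LHS](reindex_onto enum_val enum_rank) /=; last first.
  by move=> i _; rewrite enum_rankK.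
apply: eq_big => [i|i _]; first by rewrite enum_valK eqxx.
by rewrite mcoeffZ /c enum_valK mxE enum_rankK.
Qed.

End LinearAlgebra.

(** * Degrees under substitution and the counting argument *)

Section Degrees.

Variable K : fieldType.

Lemma mpoly_alg_ind n (P : {mpoly K[n]} -> Prop) :
  (forall c, P c%:MP) -> (forall i, P 'X_i) ->
  (forall p q, P p -> P q -> P (p + q)) ->
  (forall p q, P p -> P q -> P (p * q)) -> forall p, P p.
Proof.
move=> PC PX PD PM p; rewrite [p]mpolyE.
elim/big_ind: _ => [||m _]; [by rewrite -(mpolyC0 n)|exact: PD|].
rewrite -mul_mpolyC mpolyXE_id; apply: (PM) => //.
elim/big_ind: _ => [||i _]; [by rewrite -(mpolyC1 n)|exact: PM|].
elim: (m i) => [|e IHe]; first by rewrite expr0 -(mpolyC1 n).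
by rewrite exprS; apply: PM.
Qed.

Lemma comp_mpolyA l n k (p : {mpoly K[l]}) (u : l.-tuple {mpoly K[n]})
    (w : n.-tuple {mpoly K[k]}) :
  (p \mPo u) \mPo w = p \mPo [tuple tnth u i \mPo w | i < l].
Proof.
elim/mpoly_alg_ind: p => [c|i|p q Ep Eq|p q Ep Eq].
- by rewrite !comp_mpolyC.
- by rewrite !comp_mpolyXU -!tnth_nth tnth_mktuple.
- by rewrite !comp_mpolyD Ep Eq.
- by rewrite !(rmorphM (comp_mpoly _)) /= Ep Eq.
Qed.

(** The form [msize p <= a.+1] expresses that p has degree at most a and includes p = 0. *)
Lemma msizeM_leqS k (p q : {mpoly K[k]}) (a b : nat) :
  (msize p <= a.+1 -> msize q <= b.+1 -> msize (p * q) <= (a + b).+1)%N.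
Proof.
have [->|p0] := eqVneq p 0; first by rewrite mul0r msize0.
have [->|q0] := eqVneq q 0; first by rewrite mulr0 msize0.
rewrite msizeM // -(mlead_deg p0) -(mlead_deg q0) addSn !ltnS addnS ltnS.
exact: leq_add.
Qed.

Lemma msizeX_leqS k (p : {mpoly K[k]}) (a j : nat) :
  (msize p <= a.+1 -> msize (p ^+ j) <= (a * j).+1)%N.
Proof.
move=> pa; elim: j => [|j IHj]; first by rewrite expr0 msize1 muln0.
by rewrite exprS mulnS; exact: msizeM_leqS.
Qed.

Lemma msize_comp_mpolyX n k (w : n.-tuple {mpoly K[k]}) (e : nat) (m : 'X_{1..n}) :
  (forall i, msize (tnth w i) <= e.+1)%N -> (msize ('X_[m] \mPo w) <= (e * mdeg m).+1)%N.
Proof.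
move=> w_e; rewrite comp_mpolyX mdegE big_distrr /=.
elim/big_ind2: _ => [|p a q b pa qb|i _]; first by rewrite msize1.
- exact: msizeM_leqS.
- exact: msizeX_leqS.
Qed.

Lemma msize_comp_mpoly n k (w : n.-tuple {mpoly K[k]}) (e a : nat) (p : {mpoly K[n]}) :
  (forall i, msize (tnth w i) <= e.+1)%N -> (msize p <= a.+1)%N ->
  (msize (p \mPo w) <= (e * a).+1)%N.
Proof.
move=> w_e p_a; rewrite {1}[p]mpolyE raddf_sum /=.
rewrite big_seq; apply: leq_trans (msize_sum _ _ _) _.
apply/bigmax_leqP_seq => m _ m_p.
rewrite comp_mpolyZ; apply: leq_trans (msizeZ_le _ _) _.
apply: leq_trans (msize_comp_mpolyX _ w_e) _.
by rewrite ltnS leq_mul2l -ltnS (leq_trans (msize_mdeg_lt m_p) p_a) orbT.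
Qed.

Lemma deg_of_comp_automorphism k (d : nat) (f g : k.-tuple {mpoly K[k]})
    (P : {mpoly K[k]}) :
  (0 < d)%N -> (forall i, tnth f i \mPo g = 'X_i) ->
  (forall i, msize (tnth f i) <= d.+1)%N -> (msize (P \mPo f) <= d.+1)%N ->
  ((msize P).-1 <= d ^ k)%N.
Proof.
move=> d_gt0 fg f_d P_d.
have [->|P_neq0] := eqVneq P 0; first by rewrite msize0.
(* Substituting g undoes f, so a linear relation among images under f pulls back. *)
have compK q : (q \mPo f) \mPo g = q.
  rewrite comp_mpolyA -[RHS]comp_mpoly_id; congr (_ \mPo _).
  by apply: eq_from_tnth => i; rewrite !tnth_mktuple fg.
have [s size_s Es] := mnm_sum_units (mlead P).
rewrite -(mlead_deg P_neq0) -size_s /=.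
apply: leq_of_card_bmnm => // b; rewrite leqNgt; apply/negP => lt_card.
(* The D c(b) products, where D = [size s] is the degree of P. *)
pose T (x : 'I_(size s) * 'X_{1..k < b.+1}) : {mpoly K[k]} :=
  'X_[mnm_residue x.1 x.2] * P ^+ (bmnm x.2 (tnth (in_tuple s) x.1)).
have X_neq0 (m : 'X_{1..k}) : 'X_[m] != 0 :> {mpoly K[k]}.
  by rewrite -msize_poly_eq0 msizeX.
have T_neq0 x : T x != 0 by rewrite mulf_neq0 ?expf_neq0.
have T_lead x : mlead (T x) =
    (mnm_residue x.1 x.2 + mlead P *+ bmnm x.2 (tnth (in_tuple s) x.1))%MM.
  by rewrite mleadM ?expf_neq0 // mleadXm mleadX.
have T_inj : injective (fun x => mlead (T x)).
  move=> [t u] [t' u'] /=; rewrite !T_lead /= => /(mnm_residue_inj Es) [-> Eu].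
  by congr pair; apply: val_inj.
(* After substituting f, a factor P costs degree at most d, just as a single variable does. *)
have T_deg x : (msize (T x \mPo f) <= (d * (b + size s)).+1)%N.
  rewrite rmorphM rmorphXn /=.
  apply: leq_trans (msizeM_leqS (msize_comp_mpolyX _ f_d) (msizeX_leqS _ P_d)) _.
  rewrite ltnS -mulnDr leq_mul2l mdeg_mnm_residue.
  by rewrite addnC leq_add ?orbT // ?(ltnW (ltn_ord _)) // -ltnS bmdeg.
have [|c [x cx]] := mpoly_dependent T_deg; first by rewrite card_prod card_ord.
move=> /(congr1 (comp_mpoly g)); rewrite raddf_sum raddf0 /=.
under eq_bigr => y _ do rewrite comp_mpolyZ compK.
by move=> /(mlead_free T_neq0 T_inj)/(_ x)/eqP; rewrite (negPf cx).
Qed.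

End Degrees.

(** * Substitution in columns of polynomials and constant matrices *)

Section Substitution.

Variable K : fieldType.

(** The numbers of variables and of components vary independently, so that maps between K^n and the
    quotient by V can be composed. *)
Definition psub m n k (F : 'cV[{mpoly K[n]}]_m) (w : 'cV[{mpoly K[k]}]_n) :
    'cV[{mpoly K[k]}]_m :=
  map_mx (comp_mpoly [tuple w j ord0 | j < n]) F.

Definition cmx k m n (A : 'M[K]_(m, n)) : 'M[{mpoly K[k]}]_(m, n) :=
  map_mx (@mpolyC k K) A.

Lemma cmxM k l m n (A : 'M[K]_(l, m)) (B : 'M[K]_(m, n)) :
  cmx k (A *m B) = cmx k A *m cmx k B.
Proof. exact: map_mxM. Qed.

Lemma polymap_compE n (F G : polymap K n) : polymap_comp F G = psub F G.
Proof. by apply/matrixP => i j; rewrite !mxE (ord1 j). Qed.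

Lemma psubD m n k (F G : 'cV[{mpoly K[n]}]_m) (w : 'cV[{mpoly K[k]}]_n) :
  psub (F + G) w = psub F w + psub G w.
Proof. exact: map_mxD. Qed.

Lemma psub_cmx l m n k (A : 'M[K]_(l, m)) (F : 'cV[{mpoly K[n]}]_m)
    (w : 'cV[{mpoly K[k]}]_n) :
  psub (cmx n A *m F) w = cmx k A *m psub F w.
Proof.
rewrite /psub map_mxM; congr (_ *m _).
by apply/matrixP => i j; rewrite !mxE; exact: comp_mpolyC.
Qed.

Lemma psub_id n k (w : 'cV[{mpoly K[k]}]_n) : psub (polymap_id K n) w = w.
Proof.
by apply/matrixP => i j; rewrite !mxE comp_mpolyXU -tnth_nth tnth_mktuple (ord1 j).
Qed.

Lemma psub_polymap_id m n (F : 'cV[{mpoly K[n]}]_m) :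
  psub F (polymap_id K n) = F.
Proof.
apply/matrixP => i j; rewrite mxE -[RHS]comp_mpoly_id; congr (_ \mPo _).
by apply: eq_from_tnth => s; rewrite !tnth_mktuple mxE.
Qed.

Lemma psubA m l n k (F : 'cV[{mpoly K[l]}]_m) (u : 'cV[{mpoly K[n]}]_l)
    (w : 'cV[{mpoly K[k]}]_n) :
  psub (psub F u) w = psub F (psub u w).
Proof.
apply/matrixP => i j; rewrite !mxE comp_mpolyA; congr (_ \mPo _).
by apply: eq_from_tnth => s; rewrite !tnth_mktuple mxE.
Qed.

Lemma msize_mul_cmx k m n (A : 'M[K]_(m, n)) (w : 'cV[{mpoly K[k]}]_n) (b : nat) :
  (forall j, msize (w j ord0) <= b)%N -> forall i, (msize ((cmx k A *m w) i ord0) <= b)%N.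
Proof.
move=> w_b i; rewrite mxE; apply: leq_trans (msize_sum _ _ _) _.
apply/bigmax_leqP => j _; rewrite mxE mul_mpolyC.
exact: leq_trans (msizeZ_le _ _) (w_b j).
Qed.

Lemma msize_psub m n k (F : 'cV[{mpoly K[n]}]_m) (w : 'cV[{mpoly K[k]}]_n)
    (e a : nat) :
  (forall j, msize (w j ord0) <= e.+1)%N -> (forall i, msize (F i ord0) <= a.+1)%N ->
  forall i, (msize (psub F w i ord0) <= (e * a).+1)%N.
Proof.
move=> w_e F_a i; rewrite mxE; apply: msize_comp_mpoly => // j.
by rewrite tnth_mktuple.
Qed.

Lemma msize_polymap_id n i : msize (polymap_id K n i ord0) = 2%N.
Proof. by rewrite mxE msizeX mdeg1. Qed.

End Substitution.

(** * Invariance under translation by constant kernel vectors *)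

(** The chain rule: both sides are additive and obey the Leibniz rule along [phi], so constants and
    variables suffice. *)
Lemma deriv_mpoly_rmorph (K : fieldType) (n : nat) (S : comNzRingType)
    (phi : {rmorphism {mpoly K[n]} -> {poly S}}) :
  (forall c, (phi c%:MP)^`() = 0) ->
  forall q, (phi q)^`() = \sum_j phi (mderiv j q) * (phi 'X_j)^`().
Proof.
move=> phiC; elim/mpoly_alg_ind => [c|i|p q Ep Eq|p q Ep Eq].
- by rewrite phiC big1 // => j _; rewrite mderivC rmorph0 mul0r.
- rewrite (bigD1 i) //= big1 => [|j /negPf ne_j].
    rewrite mderivX mnm1E eqxx scale1r -{2}[U_(i)%MM]add0m addmK mpolyX0.
    by rewrite rmorph1 mul1r addr0.
  by rewrite mderivX mnm1E eq_sym ne_j scale0r rmorph0 mul0r.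
- rewrite rmorphD derivD Ep Eq -big_split /=; apply: eq_bigr => j _.
  by rewrite mderivD rmorphD mulrDl.
- rewrite rmorphM derivM Ep Eq mulr_suml mulr_sumr -big_split /=.
  apply: eq_bigr => j _; rewrite mderivM rmorphD !rmorphM mulrDl.
  by congr (_ + _); rewrite ?mulrA // mulrAC.
Qed.

(** Characteristic zero enters here: the coefficient of index i + 1 is killed by the nonzero scalar
    i + 1. *)
Lemma poly_deriv0 (S : idomainType) (p : {poly S}) :
  [pchar S] =i pred0 -> p^`() = 0 -> p = (p`_0)%:P.
Proof.
move=> charS0 dp0; apply/polyP => -[|i]; rewrite coefC //=.
have /eqP := congr1 (fun p : {poly S} => p`_i) dp0; rewrite coef_deriv coef0.
by rewrite -mulr_natr mulf_eq0 ((pcharf0P _).1 charS0) orbF => /eqP.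
Qed.

Lemma pchar_mpoly0 (K : fieldType) (k : nat) :
  [pchar K] =i pred0 -> [pchar {mpoly K[k]}] =i pred0.
Proof.
move=> charK0 p; rewrite -(charK0 p) !inE; congr (_ && _).
by rewrite -mpolyC_nat mpolyC_eq0.
Qed.

(* The restriction of [q] to a line of direction [v] is a univariate polynomial
   with zero derivative. *)
Lemma comp_mpoly_translate (K : fieldType) (charK0 : [pchar K] =i pred0)
    (n k : nat) (u : 'cV[{mpoly K[k]}]_n) (v : 'cV[K]_n) (q : {mpoly K[n]})
    (tau : {mpoly K[k]}) :
  \sum_j mderiv j q * (v j ord0)%:MP = 0 ->
  q \mPo [tuple (u + tau *: cmx k v) j ord0 | j < n] =
  q \mPo [tuple u j ord0 | j < n].
Proof.
move=> dq0.
(* The coefficient ring is itself polynomial, so the parameter may be evaluated at the polynomial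
   [tau] as well as at 0. *)
pose line j := (u j ord0)%:P + (v j ord0)%:MP%:P * 'X.
have [phi phiC phiX] : exists2 phi : {rmorphism {mpoly K[n]} -> {poly {mpoly K[k]}}},
    forall c, phi c%:MP = c%:MP%:P & forall i, phi 'X_i = line i.
  exists (mmap (polyC \o @mpolyC k K) line) => [c|i]; first exact: mmapC.
  by rewrite /= mmapX mmap1U.
have horner_phi t p : (phi p).[t] = p \mPo [tuple (u + t *: cmx k v) j ord0 | j < n].
  elim/mpoly_alg_ind: p => [c|i|p r Ep Er|p r Ep Er].
  - by rewrite phiC comp_mpolyC hornerC.
  - rewrite phiX comp_mpolyXU -tnth_nth tnth_mktuple !mxE.
    by rewrite !hornerE [_ * t]mulrC.
  - by rewrite rmorphD hornerD comp_mpolyD Ep Er.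
  - by rewrite rmorphM hornerM (rmorphM (comp_mpoly _)) Ep Er.
have dphi : (phi q)^`() = 0.
  rewrite deriv_mpoly_rmorph => [|c]; last by rewrite phiC derivC.
  rewrite -[RHS](rmorph0 phi) -dq0 (rmorph_sum phi) /=; apply: eq_bigr => j _.
  rewrite rmorphM phiC phiX /line derivD derivC derivM derivC derivX.
  by rewrite mul0r !add0r mulr1.
have phi_const := poly_deriv0 (pchar_mpoly0 k charK0) dphi.
have phi_at t : (phi q).[t] = (phi q)`_0 by rewrite {1}phi_const hornerC.
by rewrite -horner_phi phi_at -(phi_at 0) horner_phi scale0r addr0.
Qed.

(** The vector [cmx k A *m t] is a combination of the columns of A with polynomial coefficients;
    translate by one column at a time. *)
Lemma psub_translate (K : fieldType) (charK0 : [pchar K] =i pred0) (n m k : nat)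
    (H : polymap K n) (A : 'M[K]_(n, m)) (u : 'cV[{mpoly K[k]}]_n)
    (t : 'cV[{mpoly K[k]}]_m) :
  jacobian H *m cmx n A = 0 -> psub H (u + cmx k A *m t) = psub H u.
Proof.
move=> JA.
have -> : cmx k A *m t = \sum_i t i ord0 *: cmx k (col i A).
  apply/matrixP => i j; rewrite mxE summxE; apply: eq_bigr => s _.
  by rewrite !mxE mulrC (ord1 j).
elim: (index_enum _) u => [|i s IHs] u; first by rewrite big_nil addr0.
rewrite big_cons addrA IHs; apply/matrixP => a b; rewrite !mxE.
apply: comp_mpoly_translate => //.
have := congr1 (fun M : 'M_(n, m) => M a i) JA; rewrite !mxE => {2}<-.
by apply: eq_bigr => j _; rewrite !mxE (ord1 b).
Qed.

(** * Coordinates adapted to the kernel, and bounds on the given map *)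

(** The columns of C span a complement of the column space of A; L and E read off the coordinates
    along C and A. *)
Lemma complement_coordinates (K : fieldType) (n m : nat) (A : 'M[K]_(n, m)) :
  \rank A = m ->
  exists (C : 'M[K]_(n, n - m)) (L : 'M[K]_(n - m, n)) (E : 'M[K]_(m, n)),
  [/\ L *m C = 1%:M, L *m A = 0 & C *m L + A *m E = 1%:M].
Proof.
move=> rkA; have rkAt : \rank A^T = m by rewrite mxrank_tr.
have rkC : \rank (A^T^C)%MS = (n - m)%N by rewrite mxrank_compl rkAt.
pose B := row_base (A^T^C)%MS; rewrite -rkC.
pose S := col_mx A^T B.
have rkS : \rank S = n.
  rewrite -addsmxE (adds_eqmx (eqmx_refl _) (eq_row_base _)).
  exact/eqP/addsmx_compl_full.
have le_mn : (m <= n)%N by rewrite -{1}rkA rank_leq_row.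
have S_free : row_free S by rewrite /row_free rkS rkC subnKC.
have S_full : row_full S by rewrite /row_full rkS.
(* The two dimensions of S are equal without being the same term, so [pinvmx] serves as the
   two-sided inverse. *)
have := mulmxVp S_free; have := mulVpmx S_full.
rewrite -[pinvmx S]hsubmxK; set X := lsubmx _; set Y := rsubmx _.
rewrite /S mul_row_col mul_col_row scalar_mx_block => E1 /eq_block_mx[_ E3 _ E4].
exists B^T, Y^T, X^T; split; apply: trmx_inj.
- by rewrite trmx_mul !trmxK trmx1.
- by rewrite trmx_mul !trmxK trmx0.
- by rewrite linearD /= !trmx_mul !trmxK trmx1 addrC.
Qed.

Lemma msize_leq_polymap_degree (K : fieldType) n (F : polymap K n) i :
  (msize (F i ord0) <= (polymap_degree F).+1)%N.
Proof.
rewrite (leq_trans (leqSpred _)) // ltnS.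
exact: (leq_bigmax (F := fun j => (msize (F j ord0)).-1)).
Qed.

(** If F were constant, so would be its composite with G, whereas a variable has degree 1. *)
Lemma polymap_inverse_degree_gt0 (K : fieldType) n (F G : polymap K n) :
  (0 < n)%N -> polymap_comp F G = polymap_id K n -> (0 < polymap_degree F)%N.
Proof.
move=> n_gt0; rewrite polymap_compE lt0n => FG; apply/negP => /eqP dF.
have F_0 i : (msize (F i ord0) <= 1)%N.
  by have := msize_leq_polymap_degree F i; rewrite dF.
have := msize_psub (msize_leq_polymap_degree G) F_0 (Ordinal n_gt0).
by rewrite muln0 FG msize_polymap_id.
Qed.

(** The columns of A are a basis of V. *)
Lemma const_ker_matrix (K : fieldType) (n m : nat) (B : 'M[{mpoly K[n]}]_n)
    (V : {vspace 'cV[K]_n}) :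
  V =i const_ker B -> \dim V = m ->
  exists2 A : 'M[K]_(n, m), \rank A = m & B *m cmx n A = 0.
Proof.
move=> VE <-; pose A : 'M[K]_(n, \dim V) := \matrix_(i, j) (vbasis V)`_j i ord0.
have colA j : col j A = (vbasis V)`_j.
  by apply/matrixP => a b; rewrite !mxE (ord1 b).
exists A.
  apply/eqP; rewrite -mxrank_tr -/(row_free _) -kermx_eq0.
  apply/rowV0P => c /sub_kermxP cA.
  have /freeP := basis_free (vbasisP V).
  move=> /(_ (fun i => c 0 i)) c0; apply/rowP => i; rewrite mxE; apply: c0.
  apply/matrixP => a b; rewrite (ord1 b) summxE mxE.
  have /rowP/(_ a) := cA; rewrite !mxE => cAa; rewrite -[RHS]cAa.
  by apply: eq_bigr => j _; rewrite !mxE.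
apply/matrixP => a j.
have : (vbasis V)`_j \in V by rewrite vbasis_mem // mem_nth // size_tuple.
rewrite VE inE -colA => /eqP /matrixP/(_ a ord0).
rewrite !mxE => E0; rewrite -[RHS]E0.
by apply: eq_bigr => s _; rewrite !mxE.
Qed.

(** * Reduction modulo the kernel and the bound on the inverse *)

Section DegreeBound.

Variables (K : fieldType) (charK0 : [pchar K] =i pred0) (n m : nat).
Variables (H G : polymap K n) (d : nat) (A : 'M[K]_(n, m)).
Let x := polymap_id K n.

Lemma msize_inverse_leq : (0 < d)%N ->
  (forall i, msize (H i ord0) <= d.+1)%N -> polymap_inverse (x + H) G ->
  jacobian H *m cmx n A = 0 -> \rank A = m ->
  forall i, (msize (G i ord0) <= (d ^ (n - m)).+1)%N.
Proof.
move=> d_gt0 H_d [FG GF] JA rkA i.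
move: FG GF; rewrite !polymap_compE => FG GF.
have [C [L [E [LC LA CLAE]]]] := complement_coordinates rkA.
pose k := (n - m)%N; pose z := polymap_id K k.
have HT k' (u : 'cV[{mpoly K[k']}]_n) t : psub H (u + cmx k' A *m t) = psub H u.
  exact: psub_translate.
have Fsub k' (u : 'cV[{mpoly K[k']}]_n) : psub (x + H) u = u + psub H u.
  by rewrite psubD psub_id.
have FGsub k' (u : 'cV[{mpoly K[k']}]_n) : psub G u + psub H (psub G u) = u.
  by rewrite -Fsub -psubA FG psub_id.
have GFsub k' (u : 'cV[{mpoly K[k']}]_n) : psub G (u + psub H u) = u.
  by rewrite -Fsub -psubA GF psub_id.
(* Write u = F(w) with w = G(u). As H ignores the translation, u + A t = F(w + A t), and G undoes
   F. *)
have GT k' (u : 'cV[{mpoly K[k']}]_n) t :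
    psub G (u + cmx k' A *m t) = psub G u + cmx k' A *m t.
  by rewrite -{1}[u]FGsub addrAC -(HT _ (psub G u) t) GFsub.
have CLE k' (u : 'cV[{mpoly K[k']}]_n) :
    cmx k' C *m (cmx k' L *m u) = u - cmx k' A *m (cmx k' E *m u).
  apply/eqP; rewrite -subr_eq opprK !mulmxA -!cmxM -mulmxDl -map_mxD CLAE.
  by rewrite map_mx1 mul1mx.
have CLsub k' (u : 'cV[{mpoly K[k']}]_n) :
    exists t, cmx k' C *m (cmx k' L *m u) = u + cmx k' A *m t.
  by exists (- (cmx k' E *m u)); rewrite mulmxN CLE.
have LAt k' t : cmx k' L *m (cmx k' A *m t) = 0.
  by rewrite mulmxA -cmxM LA /cmx map_mx0 mul0mx.
have LCt k' t : cmx k' L *m (cmx k' C *m t) = t.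
  by rewrite mulmxA -cmxM LC /cmx map_mx1 mul1mx.
(* C embeds K^k as a complement of V; f and g are the maps that F and G induce modulo V, and P
   restricts H(G) to the complement. *)
pose Cz := cmx k C *m z.
pose f := cmx k L *m psub (x + H) Cz.
pose g := cmx k L *m psub G Cz.
pose P := psub H (psub G Cz).
have fg : psub f g = z.
  rewrite psub_cmx psubA psub_cmx psub_id.
  have [t ->] := CLsub k (psub G Cz).
  by rewrite Fsub HT addrAC FGsub mulmxDr LAt addr0 LCt.
(* Projecting to the complement moves F(Cz) only along V, which G carries through and H ignores;
   what remains is H(G(F(Cz))). *)
have Pf : psub P f = psub H Cz.
  rewrite !psubA psub_cmx psub_id; have [t ->] := CLsub k (psub (x + H) Cz).
  by rewrite GT Fsub GFsub HT.
have Cz_1 j : (msize (Cz j ord0) <= 2)%N.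
  by apply: msize_mul_cmx => {}j; rewrite msize_polymap_id.
have H_Cz j : (msize (psub H Cz j ord0) <= d.+1)%N.
  by rewrite -[d in leqRHS]mul1n; apply: msize_psub.
have f_d j : (msize (f j ord0) <= d.+1)%N.
  apply: msize_mul_cmx => {}j; rewrite Fsub mxE.
  apply: leq_trans (msizeD_le _ _) _.
  by rewrite geq_max H_Cz (leq_trans (Cz_1 j)).
have P_d : ((msize (P i ord0)).-1 <= d ^ k)%N.
  apply: (@deg_of_comp_automorphism K k d [tuple f j ord0 | j < k]
            [tuple g j ord0 | j < k]) => // [j|j|].
  - rewrite tnth_mktuple; have := congr1 (fun M : 'cV__ => M j ord0) fg.
    by rewrite !mxE.
  - by rewrite tnth_mktuple.
  - have := congr1 (fun M : 'cV__ => M i ord0) Pf; rewrite [LHS]mxE => ->.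
    exact: H_Cz.
(* C L x differs from x by a translation along V, so H(G) factors through the linear map L. *)
have HG : psub H G = psub P (cmx n L *m x).
  have [t Et] := CLsub n x.
  by rewrite !psubA psub_cmx psub_id Et GT HT [psub G x]psub_polymap_id.
have Lx_1 j : (msize ((cmx n L *m x) j ord0) <= 2)%N.
  by apply: msize_mul_cmx => {}j; rewrite msize_polymap_id.
have Pi_d : (msize (P i ord0) <= (d ^ k).+1)%N.
  by rewrite (leq_trans (leqSpred _)).
have HGi_d : (msize (psub H G i ord0) <= (d ^ k).+1)%N.
  rewrite HG mxE -[(d ^ k)%N]mul1n; apply: msize_comp_mpoly Pi_d => j.
  by rewrite tnth_mktuple.
have -> : G i ord0 = x i ord0 - psub H G i ord0.
  by rewrite /x -FG Fsub [(G + _) i _]mxE addrK.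
apply: leq_trans (msizeD_le _ _) _.
(* The term x has degree 1, which is at most d ^ k because d > 0. *)
by rewrite geq_max msizeN HGi_d msize_polymap_id ltnS expn_gt0 d_gt0.
Qed.

End DegreeBound.

Theorem mainTheorem2 (K : fieldType) (charK0 : [pchar K] =i pred0)
    (n : nat) (n_gt0 : (0 < n)%N) (F H : polymap K n)
    (FE : F = polymap_id K n + H)
    (d : nat) (degF : polymap_degree F = d)
    (F_invertible : exists G : polymap K n, polymap_inverse F G)
    (r : nat) (r_le_n : (r <= n)%N)
    (V : {vspace 'cV[K]_n}) (VE : V =i const_ker (jacobian H))
    (dimV : \dim V = (n - r)%N) :
  forall G : polymap K n, polymap_inverse F G ->
    (polymap_degree G <= d ^ r)%N.
Proof.
move=> G FG; have d_gt0 : (0 < d)%N.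
  by rewrite -degF; apply: polymap_inverse_degree_gt0 n_gt0 FG.1.
(* Subtracting x from F keeps the degree at most d because d >= 1. *)
have H_d i : (msize (H i ord0) <= d.+1)%N.
  have -> : H i ord0 = F i ord0 - polymap_id K n i ord0.
    by rewrite FE [(_ + H) i _]mxE addrAC subrr add0r.
  apply: leq_trans (msizeD_le _ _) _.
  by rewrite geq_max msizeN msize_polymap_id !ltnS d_gt0 -degF msize_leq_polymap_degree.
have [A rkA JA] := const_ker_matrix VE dimV.
apply/bigmax_leqP => i _; rewrite FE in FG.
(* A has n - r columns, so the exponent obtained is n - (n - r) = r. *)
have := msize_inverse_leq charK0 d_gt0 H_d FG JA rkA i.
by rewrite subKn //; case: (msize _).
Qed.
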